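(* Let $R$ be a semilocal ring. The following are equivalent: (1) $R$ is a UNC ring. (2) $R$ is a nil-clean ring. (3) $J(R)$ is nil and $R/J(R)$ is a finite direct sum of matrix rings over $\mathbb F_2$.
   Context: Rings are associative with identity, not necessarily commutative. $J(R)$ is the Jacobson radical of $R$. A ring $R$ is semilocal if $R/J(R)$ is semisimple Artinian. An element $a\in R$ is nil-clean if $a=e+b$ with $e^2=e\in R$ and $b\in R$ nilpotent ($e$ and $b$ need not commute). The ring $R$ is nil-clean if every element of $R$ is nil-clean, and $R$ is a UNC ring if every unit of $R$ is nil-clean. ''Matrix ring over $\mathbb F_2$'' means a full matrix ring $\mathbb M_n(\mathbb F_2)$ with $n\ge 1$ (the sizes may vary among the summands), where $\mathbb F_2$ is the field with two elements. An ideal is nil if all its elements are nilpotent. *)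

(* Defs.v *)
From HB Require Import structures.
From mathcomp Require Import all_boot all_order all_algebra.
From mathcomp Require Import ring_quotient generic_quotient.
From mathcomp Require Import boolp classical_sets.

Set Implicit Arguments.
Unset Strict Implicit.
Unset Printing Implicit Defensive.

Import GRing.Theory.

Local Open Scope classical_set_scope.
Local Open Scope ring_scope.

(* Rings are [pzRingType]s: associative, unital, not necessarily commutative.
   The zero ring is allowed. *)

Section Elements.
Variable R : pzRingType.
Implicit Types a u : R.

(* Two-sided invertibility; [GRing.unit] would require a [unitRingType]. *)
Definition invertible u : Prop := exists v, u * v = 1 /\ v * u = 1.

Definition nilpotent_elt a : Prop := exists n : nat, a ^+ n = 0.

Definition nil_clean_elt a : Prop :=
  exists e b, [/\ e ^+ 2 = e, nilpotent_elt b & a = e + b].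

End Elements.

Definition nil_clean_ring (R : pzRingType) : Prop :=
  forall a : R, nil_clean_elt a.

Definition UNC_ring (R : pzRingType) : Prop :=
  forall u : R, invertible u -> nil_clean_elt u.

Section LeftIdeals.
Variable R : pzRingType.
Implicit Types I K M : set R.

(* Closure under opposites follows by taking [a = -1]. *)
Definition left_ideal I : Prop :=
  [/\ I 0, forall x y, I x -> I y -> I (x + y) & forall a x, I x -> I (a * x)].

Definition maximal_left_ideal M : Prop :=
  [/\ left_ideal M, M <> setT &
      forall I, left_ideal I -> M `<=` I -> I <> setT -> I = M].

(* Every submodule of the left regular module is a direct summand. *)
Definition semisimple_ring : Prop :=
  forall I, left_ideal I ->
  exists K, [/\ left_ideal K, I `&` K = [set 0] &
                forall x, exists y z, [/\ I y, K z & x = y + z]].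

Definition left_artinian : Prop :=
  forall I_ : nat -> set R,
    (forall n, left_ideal (I_ n)) -> (forall n, I_ n.+1 `<=` I_ n) ->
  exists n, forall m, (n <= m)%N -> I_ m = I_ n.

Definition semisimple_artinian : Prop := semisimple_ring /\ left_artinian.

(* Boolean-valued, through [asbool], so that the quotients of MathComp apply;
   over the zero ring it is everything. *)
Definition jacobson : {pred R} :=
  fun x => `[< forall M, maximal_left_ideal M -> M x >].

Definition nil_set (I : {pred R}) : Prop := forall x, x \in I -> nilpotent_elt x.

Lemma left_idealN I x : left_ideal I -> I x -> I (- x).
Proof. by case=> _ _ IM Ix; rewrite -mulN1r; apply: IM. Qed.

Lemma left_idealT I : left_ideal I -> I 1 -> I = setT.
Proof.
case=> _ _ IM I1; apply/seteqP; split=> // x _.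
by rewrite -[x]mulr1; apply: IM.
Qed.

Lemma jacobsonP x :
  reflect (forall M, maximal_left_ideal M -> M x) (x \in jacobson).
Proof. by rewrite unfold_in; apply: asboolP. Qed.

Fact jacobson_zmod_closed : zmod_closed jacobson.
Proof.
split=> [|x y /jacobsonP Jx /jacobsonP Jy]; apply/jacobsonP => M Mmax.
  by have [[]] := Mmax.
have [Mid _ _] := Mmax; have [_ MD _] := Mid.
by apply: MD; [exact: Jx | apply: left_idealN => //; exact: Jy].
Qed.

HB.instance Definition _ :=
  GRing.isZmodClosed.Build R jacobson jacobson_zmod_closed.

Lemma jacobson_mull a x : x \in jacobson -> a * x \in jacobson.
Proof.
move=> /jacobsonP Jx; apply/jacobsonP => M Mmax.
by have [[_ _ MM] _ _] := Mmax; apply: MM; exact: Jx.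
Qed.

(* If [M] is a maximal left ideal and [r] is not in [M], then
   [{y | y * r \in M}] is again a maximal left ideal. *)
Lemma jacobson_mulr x r : x \in jacobson -> x * r \in jacobson.
Proof.
move=> /jacobsonP Jx; apply/jacobsonP => M Mmax.
have [Mid MT Mmx] := Mmax; have [M0 MD MM] := Mid.
have [Mr|nMr] := pselect (M r); first exact: MM.
suff: maximal_left_ideal [set y | M (y * r)] by move=> /Jx.
split.
- split=> [|y z /= My Mz|a y /= My]; rewrite /= ?mul0r ?mulrDl -?mulrA //.
    exact: MD.
  exact: MM.
- by move=> /seteqP[_ /(_ 1 I)] /=; rewrite mul1r.
move=> N Nid MN NT; have [N0 ND NM] := Nid.
apply/seteqP; split=> // n Nn; apply: contrapT => /= nMnr.
apply: NT; apply: left_idealT => //.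
pose L : set R := [set z | exists m s, M m /\ z = m + s * (n * r)].
have Lid : left_ideal L.
  split=> [|z1 z2 [m1 [s1 [Mm1 ->]]] [m2 [s2 [Mm2 ->]]]|a z [m [s [Mm ->]]]].
  - by exists 0, 0; rewrite mul0r addr0.
  - by exists (m1 + m2), (s1 + s2); split; [exact: MD | rewrite mulrDl addrACA].
  - by exists (a * m), (a * s); split; [exact: MM | rewrite mulrDr mulrA].
have ML : M `<=` L by move=> m Mm; exists m, 0; rewrite mul0r addr0.
have Lnr : L (n * r) by exists 0, 1; rewrite mul1r add0r.
have LT : L = setT.
  by apply: contrapT => /(Mmx _ Lid ML) LM; rewrite LM in Lnr.
have [m [s [Mm rE]]] : L r by rewrite LT.
rewrite -(subrK (s * n) 1); apply: ND; last exact: NM.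
by apply: MN; rewrite /= mulrBl mul1r -mulrA {1}rE addrK.
Qed.

End LeftIdeals.

Arguments jacobson : clear implicits.

Section JacobsonQuotient.
Variable R : pzRingType.

(* MathComp builds the additive quotient for every additive subgroup, but its
   ring structure only for commutative rings. *)
Definition jacobson_quot := Quotient.quot (jacobson R).

HB.instance Definition _ := GRing.Zmodule.on jacobson_quot.

Local Notation Q := jacobson_quot.
Local Notation pr := (\pi_(Quotient.quot (jacobson R)))%qT.

Definition jq_one : Q := pr 1.
Definition jq_mul : Q -> Q -> Q :=
  lift_op2 (Quotient.quot (jacobson R)) *%R.

Lemma jq_eqP (x y : R) : reflect (pr x = pr y) (x - y \in jacobson R).
Proof. by rewrite Quotient.idealrBE; apply: eqP. Qed.

Lemma jq_mulE (x y : R) : jq_mul (pr x) (pr y) = pr (x * y).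
Proof.
unlock jq_mul; apply/jq_eqP; set x' := repr _; set y' := repr _.
have Jx : x' - x \in jacobson R by apply/jq_eqP; rewrite reprK.
have Jy : y' - y \in jacobson R by apply/jq_eqP; rewrite reprK.
have -> : x' * y' - x * y = (x' - x) * y' + x * (y' - y).
  by rewrite mulrBl mulrBr addrA subrK.
by apply: rpredD; [apply: jacobson_mulr | apply: jacobson_mull].
Qed.

Lemma jq_addE (x y : R) : (pr x : Q) + pr y = pr (x + y).
Proof. by symmetry; exact: Quotient.pi_add. Qed.

Fact jq_mulA : associative jq_mul.
Proof.
elim/quotW=> x; elim/quotW=> y; elim/quotW=> z.
by rewrite !jq_mulE mulrA.
Qed.

Fact jq_mul1l : left_id jq_one jq_mul.
Proof. by elim/quotW=> x; rewrite jq_mulE mul1r. Qed.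

Fact jq_mul1r : right_id jq_one jq_mul.
Proof. by elim/quotW=> x; rewrite jq_mulE mulr1. Qed.

Fact jq_mulDl : left_distributive jq_mul +%R.
Proof.
elim/quotW=> x; elim/quotW=> y; elim/quotW=> z.
by rewrite (jq_addE x y) !jq_mulE (jq_addE (x * z)) mulrDl.
Qed.

Fact jq_mulDr : right_distributive jq_mul +%R.
Proof.
elim/quotW=> x; elim/quotW=> y; elim/quotW=> z.
by rewrite (jq_addE y z) !jq_mulE (jq_addE (x * y)) mulrDr.
Qed.

HB.instance Definition _ := GRing.Zmodule_isPzRing.Build Q
  jq_mulA jq_mul1l jq_mul1r jq_mulDl jq_mulDr.

End JacobsonQuotient.

Definition semilocal (R : pzRingType) : Prop :=
  semisimple_artinian (jacobson_quot R).

(* Finite direct sum (= product) of rings, with componentwise operations. *)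
Section DirectSum.
Variables (I : finType) (F : I -> pzRingType).

Definition ring_dsum := {dffun forall i : I, F i}.

HB.instance Definition _ := Choice.on ring_dsum.

Implicit Types f g h : ring_dsum.

Definition dsum_zero : ring_dsum := [ffun i => 0 : F i].
Definition dsum_one : ring_dsum := [ffun i => 1 : F i].
Definition dsum_opp f : ring_dsum := [ffun i => - f i : F i].
Definition dsum_add f g : ring_dsum := [ffun i => f i + g i : F i].
Definition dsum_mul f g : ring_dsum := [ffun i => f i * g i : F i].

Fact dsum_addA : associative dsum_add.
Proof. by move=> f g h; apply/ffunP => i; rewrite !ffunE addrA. Qed.
Fact dsum_addC : commutative dsum_add.
Proof. by move=> f g; apply/ffunP => i; rewrite !ffunE addrC. Qed.
Fact dsum_add0 : left_id dsum_zero dsum_add.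
Proof. by move=> f; apply/ffunP => i; rewrite !ffunE add0r. Qed.
Fact dsum_addN : left_inverse dsum_zero dsum_opp dsum_add.
Proof. by move=> f; apply/ffunP => i; rewrite !ffunE addNr. Qed.

HB.instance Definition _ := GRing.isZmodule.Build ring_dsum
  dsum_addA dsum_addC dsum_add0 dsum_addN.

Fact dsum_mulA : associative dsum_mul.
Proof. by move=> f g h; apply/ffunP => i; rewrite !ffunE mulrA. Qed.
Fact dsum_mul1l : left_id dsum_one dsum_mul.
Proof. by move=> f; apply/ffunP => i; rewrite !ffunE mul1r. Qed.
Fact dsum_mul1r : right_id dsum_one dsum_mul.
Proof. by move=> f; apply/ffunP => i; rewrite !ffunE mulr1. Qed.
Fact dsum_mulDl : left_distributive dsum_mul +%R.
Proof. by move=> f g h; apply/ffunP => i; rewrite !ffunE mulrDl. Qed.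
Fact dsum_mulDr : right_distributive dsum_mul +%R.
Proof. by move=> f g h; apply/ffunP => i; rewrite !ffunE mulrDr. Qed.

HB.instance Definition _ := GRing.Zmodule_isPzRing.Build ring_dsum
  dsum_mulA dsum_mul1l dsum_mul1r dsum_mulDl dsum_mulDr.

End DirectSum.

Definition ring_isomorphic (A B : pzRingType) : Prop :=
  exists f : {rmorphism A -> B}, bijective f.

(* [k = 0] is allowed: the empty direct sum is the zero ring. *)
Definition dsum_of_matrix_rings_F2 (A : pzRingType) : Prop :=
  exists (k : nat) (n : 'I_k -> nat),
    (forall i, (0 < n i)%N) /\
    ring_isomorphic A (ring_dsum (fun i : 'I_k => 'M['F_2]_(n i))).

(* Main.v *)
(* (1) => (3).  If [R] is UNC and [j] is in [J(R)], then [1 + j = e + b] makes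
   [1 - e] both idempotent and nilpotent modulo [J(R)], so [e = 1] and [j = b]
   is nilpotent.  Units lift modulo [J(R)], so [Q = R/J(R)] is UNC.  In [Q], for
   a primitive idempotent [e] and [d <> 0, e] in the division ring [eQe], the
   unit [d + (1 - e)] is not nil-clean: otherwise an idempotent [f] plus the
   rank one element [d - e] would be nilpotent, which forces [f] to have rank
   one as well, and the resulting 2 x 2 problem over [eQe] has no solution.
   Hence all corners [eQe] are F_2, every Peirce component [e_i Q e_j] has at
   most one nonzero element, and these elements are matrix units exhibiting [Q]
   as a product of matrix rings over F_2; Wedderburn-Artin is not needed.

   (3) => (2).  Idempotents lift modulo the nil ideal [J(R)], which reduces the
   claim to a single matrix [T] over F_2.  If the Krylov space of a vector is
   proper, [T] is block triangular and one uses induction on the size.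
   Otherwise [T] is cyclic and, in a well-chosen basis, [T] minus the shift is
   idempotent, except in size 2 and trace 0, where [T] is a scalar plus a
   nilpotent. *)

Require Import Defs.
From HB Require Import structures.
From mathcomp Require Import all_boot all_order all_algebra.
From mathcomp Require Import boolp classical_sets.

Set Implicit Arguments.
Unset Strict Implicit.
Unset Printing Implicit Defensive.

Import GRing.Theory.

Local Open Scope ring_scope.

(** * Units, idempotents and the Jacobson radical *)

Section Units.
Variable R : pzRingType.
Implicit Types I M : set R.

(* Subsets of [I] are admitted in [P] so that the empty chain has its union
   in [P]. *)
Lemma proper_left_ideal_sub_maximal I :
  left_ideal I -> ~ I 1 -> exists M, maximal_left_ideal M /\ (I `<=` M)%classic.
Proof.
move=> Iid I1.
pose P : set (set R) := fun X =>
  (forall x, X x -> I x) \/ [/\ left_ideal X, ~ X 1 & (I `<=` X)%classic].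
have [F FP tot|M [PM Mmax]] := @Zorn_bigcup R P.
  have [[X0 FX0 [[X00 XD0 XM0] nX01 IX0]]|nF] := pselect
      (exists2 X, F X & [/\ left_ideal X, ~ X 1 & (I `<=` X)%classic]); last
        first.
    left=> x [X FX Xx]; case: (FP _ FX) => [|H]; first exact.
    by case: nF; exists X.
  right; split.
  - split; first by exists X0.
    + move=> x y [X FX Xx] [Y FY Yy].
      have clos Z a b : F Z -> Z a -> Z b -> (\bigcup_(X in F) X)%classic (a +
        b).
        move=> FZ Za Zb; case: (FP _ FZ) => [ZI|[[_ ZD _] _ _]].
          by exists X0 => //; apply: XD0; apply: IX0; apply: ZI.
        by exists Z => //; exact: ZD.
      by case: (tot _ _ FX FY) => /(_ _ _) sub;
        [apply: (clos Y) | apply: (clos X)] => //; exact: sub.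
    + move=> a x [X FX Xx]; case: (FP _ FX) => [XI|[[_ _ XM] _ _]].
        by exists X0 => //; apply: XM0; apply: IX0; apply: XI.
      by exists X => //; exact: XM.
  - by move=> [X FX X1]; case: (FP _ FX) => [/(_ 1 X1)|[_ /(_ X1)]].
  - by move=> x Ix; exists X0 => //; exact: IX0.
have PI : P I by right; split.
have IM : (I `<=` M)%classic.
  case: PM => [MI|[]//].
  have [->//|nMI] := pselect (M = I).
  by case: (Mmax I) => //; split=> // IM; apply: nMI; apply/seteqP; split.
have Mid : left_ideal M.
  by case: PM => [MI|[]//]; have -> : M = I by apply/seteqP; split.
have M1 : ~ M 1 by case: PM => [MI /MI//|[]//].
exists M; split=> //; split=> //; first by move=> MT; apply: M1; rewrite MT.
move=> N Nid MN NT; apply: contrapT => nNM; apply: (Mmax N).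
  by split=> // NM; apply: nNM; apply/seteqP; split.
right; split=> //; first by move=> /(left_idealT Nid).
by move=> x /IM /MN.
Qed.

(** If [1 + y] had no left inverse, a maximal left ideal containing it would contain [y] and hence
    1. The left inverse [w = 1 - w * x] is again 1 plus a radical element, so it is left invertible
    too. *)
Lemma jacobson_invertible x : x \in jacobson R -> invertible (1 + x).
Proof.
have linv y : y \in jacobson R -> exists w, w * (1 + y) = 1.
  move=> Jy; apply: contrapT => nw.
  pose I : set R := fun z => exists w, z = w * (1 + y).
  have Iid : left_ideal I.
    split; first by exists 0; rewrite mul0r.
      by move=> _ _ [a ->] [b ->]; exists (a + b); rewrite mulrDl.
    by move=> a _ [b ->]; exists (a * b); rewrite mulrA.
  have [|M [Mmax IM]] := proper_left_ideal_sub_maximal Iid.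
    by move=> [w w1]; apply: nw; exists w.
  have [Mid MT _] := Mmax; apply: MT; apply: left_idealT => //.
  have [_ MD _] := Mid.
  rewrite -(addrK y 1); apply: MD; first by apply: IM; exists 1; rewrite mul1r.
  by apply: left_idealN => //; move/jacobsonP: Jy; apply.
move=> Jx; have [w w1] := linv _ Jx.
have wE : w = 1 + (- (w * x)) by rewrite -w1 mulrDr mulr1 addrK.
have [z zw] : exists z, z * w = 1.
  by rewrite wE; apply: linv; rewrite rpredN jacobson_mull.
by exists w; split=> //; rewrite -[LHS]mul1r -{1}zw -!mulrA (mulrA w) w1 mul1r.
Qed.

Lemma jacobson_idempotent (e : R) : e \in jacobson R -> e ^+ 2 = e -> e = 0.
Proof.
move=> Je e2; have [|v [_ v1]] := @jacobson_invertible (- e).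
  by rewrite rpredN.
have : v * (1 - e) * e = e by rewrite v1 mul1r.
by rewrite -mulrA mulrBl mul1r -expr2 e2 subrr mulr0.
Qed.

End Units.

(** * Passage between [R] and [R/J(R)] *)

Section Quotient.
Variable R : pzRingType.

Definition jq_pr (x : R) : jacobson_quot R :=
  (\pi_(Quotient.quot (jacobson R)) x)%qT.

Fact jq_pr_additive : additive jq_pr.
Proof.
move=> x y; apply/eqP; rewrite eq_sym subr_eq; apply/eqP.
by rewrite /jq_pr jq_addE subrK.
Qed.

Fact jq_pr_monoid_morphism : monoid_morphism jq_pr.
Proof. by split=> // x y; rewrite /jq_pr -jq_mulE. Qed.

HB.instance Definition _ :=
  GRing.isZmodMorphism.Build R (jacobson_quot R) jq_pr jq_pr_additive.
HB.instance Definition _ :=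
  GRing.isMonoidMorphism.Build R (jacobson_quot R) jq_pr jq_pr_monoid_morphism.

Lemma jq_pr_surj (a : jacobson_quot R) : exists x, jq_pr x = a.
Proof. by elim/quotW: a => x; exists x. Qed.

Lemma jq_pr_eq0 x : (x \in jacobson R) <-> jq_pr x = 0.
Proof.
rewrite -[x in x \in _]subr0 -(rmorph0 jq_pr).
by split=> /jq_eqP.
Qed.

(** If [v] lifts the inverse, [u * v] and [v * u] lie in [1 + J(R)] and are invertible, which gives
    [u] an inverse on each side. *)
Lemma invertible_lift u : invertible (jq_pr u) -> invertible u.
Proof.
have lift1 x y : jq_pr x * jq_pr y = 1 -> invertible (x * y).
  move=> xy1; rewrite -[x * y](subrK 1) addrC; apply: jacobson_invertible.
  by apply/jq_pr_eq0; rewrite rmorphB rmorphM rmorph1 xy1 subrr.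
move=> [v' [uv vu]]; have [v vE] := jq_pr_surj v'; rewrite -vE in uv vu.
have [s [s1 _]] := lift1 _ _ uv; have [t [_ t1]] := lift1 _ _ vu.
rewrite -mulrA in s1; rewrite mulrA in t1.
exists (v * s); split=> //.
by rewrite -[v * s]mul1r -{1}t1 -(mulrA _ u) s1 mulr1.
Qed.

Lemma UNC_jacobson_nil : UNC_ring R -> nil_set (jacobson R).
Proof.
move=> unc x Jx; have [e [b [e2 [n bn] xE]]] := unc _ (jacobson_invertible Jx).
have fE : 1 - e = b - x.
  by apply/eqP; rewrite subr_eq addrAC eq_sym subr_eq addrC -xE addrC.
have f2 : (1 - e) ^+ 2 = 1 - e.
  by rewrite expr2 mulrBr mulr1 mulrBl mul1r -expr2 e2 subrr subr0.
have fX k : (1 - e) ^+ k.+1 = 1 - e.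
  by elim: k => [//|k IH]; rewrite exprS IH -expr2.
have prf : jq_pr (1 - e) = jq_pr b.
  by rewrite fE rmorphB /= (jq_pr_eq0 x).1 // subr0.
have f0 : 1 - e = 0.
  apply: jacobson_idempotent => //; apply/jq_pr_eq0.
  by rewrite -(fX n) rmorphXn /= prf -rmorphXn exprS bn mulr0 rmorph0.
by exists n; rewrite -bn; congr (_ ^+ _); apply/eqP; rewrite eq_sym -subr_eq0
  -fE f0.
Qed.

Lemma UNC_jacobson_quot : UNC_ring R -> UNC_ring (jacobson_quot R).
Proof.
move=> unc u'; have [u <-] := jq_pr_surj u' => /invertible_lift /unc.
move=> [e [b [e2 [n bn] ->]]]; exists (jq_pr e), (jq_pr b); split.
- by rewrite -rmorphXn e2.
- by exists n; rewrite -rmorphXn bn rmorph0.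
- exact: rmorphD.
Qed.

(* The lift is [1 - (1 - x ^ m) ^ m] where [(x (1 - x)) ^ m = 0]: it is a
   multiple of [x ^ m], and its complement is a multiple of [(1 - x) ^ m]. *)
Lemma idempotent_lift (x : R) : nil_set (jacobson R) ->
  jq_pr x ^+ 2 = jq_pr x -> exists e, e ^+ 2 = e /\ jq_pr e = jq_pr x.
Proof.
move=> Jnil x2; have idX (S : pzRingType) (a : S) k : a ^+ 2 = a -> a ^+ k.+1 =
  a.
  by move=> a2; elim: k => [//|k IH]; rewrite exprS IH -expr2.
have [|n xn] := Jnil (x * (1 - x)).
  by apply/jq_pr_eq0; rewrite rmorphM rmorphB rmorph1 /= mulrBr mulr1 -expr2 x2
    subrr.
have cx : GRing.comm x (1 - x) by apply: commrB => //; exact: commr1.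
have {xn} : x ^+ n.+1 * (1 - x) ^+ n.+1 = 0.
  by rewrite -exprMn_comm // exprSr xn mul0r.
set m := n.+1; set y := x ^+ m => xm.
pose s := \sum_(i < m) x ^+ i; pose t := \sum_(i < m) (1 - y) ^+ i.
have cxs : GRing.comm (1 - x) s.
  by apply: commr_sum => i _; apply: commrX; apply: commr_sym.
have sE : 1 - y = (1 - x) * s.
  by rewrite -[1 - y]opprB subrX1 -mulNr opprB.
have tE : 1 - (1 - y) ^+ m = t * y.
  have -> : t * y = y * t.
    apply: commr_sym; apply: commr_sum => i _; apply: commrX.
    by apply: commrB => //; exact: commr1.
  by rewrite -[LHS]opprB subrX1 -mulNr opprB opprB addrC subrK.
exists (1 - (1 - y) ^+ m); split.
  rewrite expr2 mulrBr mulr1 {2}tE sE exprMn_comm // -mulrA (mulrA y) xm.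
  by rewrite mul0r mulr0 subr0.
have prx1 : (1 - jq_pr x) ^+ 2 = 1 - jq_pr x.
  by rewrite expr2 mulrBr mulr1 mulrBl mul1r -expr2 x2 subrr subr0.
rewrite rmorphB rmorphXn rmorphB rmorph1 rmorphXn /= (idX _ _ _ x2).
by rewrite (idX _ _ _ prx1) opprB addrC subrK.
Qed.

(** Only the idempotent is lifted: [a - e] is nilpotent modulo [J(R)], so one of its powers lies in
    a nil ideal. *)
Lemma nil_clean_lift : nil_set (jacobson R) ->
  nil_clean_ring (jacobson_quot R) -> nil_clean_ring R.
Proof.
move=> Jnil ncQ a; have [e' [b [e2 [n bn] aE]]] := ncQ (jq_pr a).
have [x xE] := jq_pr_surj e'; rewrite -xE in e2 aE.
have [e [ee eE]] := idempotent_lift Jnil e2.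
exists e, (a - e); split=> //; last by rewrite addrC subrK.
have [|k ak] := Jnil ((a - e) ^+ n); last by exists (n * k)%N; rewrite exprM.
by apply/jq_pr_eq0; rewrite rmorphXn rmorphB /= aE eE addrC addrA addNr add0r.
Qed.

End Quotient.

(** * Semisimple UNC rings *)

Section Semisimple.
Variable A : pzRingType.
Implicit Types a e f g h x : A.

Definition primitive e :=
  [/\ e * e = e, e <> 0 &
      forall g, g * g = g -> e * g = g -> g * e = g -> g = 0 \/ g = e].

Definition primitive_decomposable g := exists (I : finType) (e : I -> A),
  [/\ forall i, primitive (e i), forall i j, i != j -> e i * e j = 0
    & \sum_i e i = g].

Lemma primitive_decomposableD g h : g * h = 0 -> h * g = 0 ->
  primitive_decomposable g -> primitive_decomposable h ->
  primitive_decomposable (g + h).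
Proof.
move=> gh hg [I [e [pe oe eg]]] [J [f [pf of_ fh]]].
have eE i : e i * g = e i /\ g * e i = e i.
  rewrite -eg mulr_sumr mulr_suml (bigD1 i) //= big1 => [|j ji]; last first.
    by rewrite oe // eq_sym.
  rewrite (bigD1 i) //= big1 => [|j ji]; last by rewrite oe.
  by have [ee _ _] := pe i; rewrite ee addr0.
have fE j : f j * h = f j /\ h * f j = f j.
  rewrite -fh mulr_sumr mulr_suml (bigD1 j) //= big1 => [|i ij]; last first.
    by rewrite of_ // eq_sym.
  rewrite (bigD1 j) //= big1 => [|i ij]; last by rewrite of_.
  by have [ff _ _] := pf j; rewrite ff addr0.
pose k (s : I + J) := match s with inl i => e i | inr j => f j end.
exists (I + J)%type, k; split.
- by case.
- move=> [i|j] [i'|j'] //= ne; [exact: oe| | |exact: of_].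
    by rewrite -(eE i).1 -(fE j').2 -mulrA (mulrA g) gh mul0r mulr0.
  by rewrite -(fE j).1 -(eE i').2 -mulrA (mulrA h) hg mul0r mulr0.
- by rewrite big_sumType /= eg fh.
Qed.

(** An idempotent without such a decomposition is neither 0 nor primitive, so it splits into two
    orthogonal idempotents, one of which is again bad. Iteration gives a strictly descending chain
    of left ideals. *)
Lemma artinian_primitive_decomposition g :
  left_artinian A -> g * g = g -> primitive_decomposable g.
Proof.
move=> art gg; apply: contrapT => ndg.
pose bad x := x * x = x /\ ~ primitive_decomposable x.
have step x : exists y, bad x -> [/\ bad y, x * y = y, y * x = y & y <> x].
  have [bx|nbx] := pselect (bad x); last by exists 0.
  have [xx ndx] := bx.
  have x0 : x <> 0.
    move=> x0; apply: ndx; exists void, (fun=> 0); split; [by case|by case|].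
    by rewrite x0 big1.
  have nprim : ~ primitive x.
    move=> px; apply: ndx; exists unit, (fun=> x).
    split; [by []|by do 2!case|by rewrite (big_pred1 tt) //; case].
  apply: contrapT => H; apply: nprim; split=> // y yy xy yx.
  have [->|y0] := pselect (y = 0); [by left|right].
  apply: contrapT => yx'.
  have dy : primitive_decomposable y.
    by apply: contrapT => ndy; apply: H; exists y.
  have zz : (x - y) * (x - y) = x - y.
    by rewrite mulrBl !mulrBr xx yy xy yx subrr subr0.
  have dz : primitive_decomposable (x - y).
    apply: contrapT => ndz; apply: H; exists (x - y) => _; split=> //.
    - by rewrite mulrBr xx xy.
    - by rewrite mulrBl xx yx.
    - by move=> /eqP; rewrite -subr_eq0 addrAC subrr sub0r oppr_eq0 => /eqP.
  apply: ndx; rewrite -(subrK y x); apply: primitive_decomposableD => //.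
    by rewrite mulrBl xy yy subrr.
  by rewrite mulrBr yx yy subrr.
have [F FP] := choice step.
pose u n := iter n F g.
have ubad n : bad (u n) by elim: n => [|n /FP[]].
(* This is the left ideal [A u_n], because [u n] is idempotent. *)
pose L n : set A := fun x => x * u n = x.
have [||n nP] := art L.
- move=> n; rewrite /L; split; first exact: mul0r.
    by move=> x y xu yu; rewrite mulrDl xu yu.
  by move=> a x xu; rewrite -mulrA xu.
- move=> n x; rewrite /L => <-; have [_ _ vu _] := FP _ (ubad n).
  by rewrite -mulrA vu.
have [_ uv _] := FP _ (ubad n); case; rewrite -[RHS]/(u n).
have : L n.+1 (u n) by rewrite nP // /L; have [] := ubad n.
by rewrite /L /= uv.
Qed.

Definition von_neumann_regular := forall a, exists x, a * x * a = a.

(** Write [1 = x * a + z] along the decomposition of [A] into [A a] and [K]; then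
    [a * z = a - a * x * a] lies in both summands. *)
Lemma semisimple_von_neumann_regular : semisimple_ring A -> von_neumann_regular.
Proof.
move=> ss a; pose I : set A := fun x => exists y, x = y * a.
have [|K [Kid IK decomp]] := ss I.
  split; first by exists 0; rewrite mul0r.
    by move=> _ _ [x ->] [y ->]; exists (x + y); rewrite mulrDl.
  by move=> b _ [y ->]; exists (b * y); rewrite mulrA.
have [_ [z [[x ->] Kz one]]] := decomp 1; exists x.
have : [set 0]%classic (a * z).
  rewrite -IK; split; last by have [_ _ KM] := Kid; exact: KM.
  exists (1 - a * x); rewrite mulrBl mul1r -mulrA.
  by rewrite -{2}[a]mulr1 one mulrDr addrC addKr.
by move=> /= az0; rewrite -mulrA -[RHS]mulr1 one mulrDr az0 addr0.
Qed.

Hypothesis reg : von_neumann_regular.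

(** The corner [e A e] is a division ring: for an inner inverse [y] of [d] in it, [d * y] and
    [y * d] are nonzero idempotents, so primitivity makes both equal to [e]. *)
Lemma primitive_corner_inv e d : primitive e -> e * d = d -> d * e = d -> d <>
  0 ->
  exists y, [/\ e * y = y, y * e = y, d * y = e & y * d = e].
Proof.
move=> [ee e0 emin] ed de d0; have [z dzd] := reg d.
have [y [ey ye dyd]] : exists y, [/\ e * y = y, y * e = y & d * y * d = d].
  exists (e * z * e); split; first by rewrite !mulrA ee.
    by rewrite -mulrA ee.
  by rewrite !mulrA de -mulrA ed.
exists y; split=> //.
- case: (emin (d * y)) => //.
  + by rewrite mulrA dyd.
  + by rewrite mulrA ed.
  + by rewrite -mulrA ye.
  + by move=> dy0; move: d0; rewrite -dyd dy0 mul0r.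
- case: (emin (y * d)) => //.
  + by rewrite -mulrA (mulrA d) dyd.
  + by rewrite mulrA ey.
  + by rewrite -mulrA de.
  + by move=> dy0; move: d0; rewrite -dyd -mulrA dy0 mulr0.
Qed.

(** Iteration gives [b ^+ n * x = x * d ^+ n], and [d'] cancels the powers of [d]. *)
Lemma nilpotent_eigen b x d d' e :
  nilpotent_elt b -> b * x = x * d -> d * d' = e -> d * e = d -> x * e = x -> x
    = 0.
Proof.
move=> [n bn] bx dd' de xe.
have bX k : b ^+ k * x = x * d ^+ k.
  elim: k => [|k IH]; first by rewrite mul1r mulr1.
  by rewrite exprSr -mulrA bx mulrA IH -mulrA -exprSr.
have: x * d ^+ n = 0 by rewrite -bX bn mul0r.
elim: n {bn} => [|n IH]; first by rewrite mulr1.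
move=> xd; apply: IH; case: n xd => [|n] xd.
  by rewrite mulr1 -xe -dd' mulrA -[d]expr1 xd mul0r.
have := congr1 ( *%R^~ d') xd.
by rewrite exprSr -!mulrA dd' exprSr -(mulrA _ d e) de mul0r.
Qed.

(* The failing unit is [d + (1 - e)]. Below, [f A] meets the kernel of left
   multiplication by [e] trivially, so [f = x (e f)] has rank at most one; then
   [x] and [e] span a right submodule on which [b] acts by the matrix
   [[e, p], [c, c]], which has an eigenvector of eigenvalue [d] if [p = e] and
   is invertible otherwise. *)
Lemma UNC_primitive_corner e d : UNC_ring A -> primitive e ->
  e * d = d -> d * e = d -> d <> 0 -> d = e.
Proof.
move=> unc pe ed de d0; apply: contrapT => dne.
have [ee e0 _] := pe.
have [d' [ed' d'e dd' d'd]] := primitive_corner_inv pe ed de d0.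
pose c := d - e.
have ec : e * c = c by rewrite mulrBr ed ee.
have ce : c * e = c by rewrite mulrBl de ee.
have c0 : c <> 0 by move=> /eqP; rewrite subr_eq0 => /eqP.
have dE : d = c + e by rewrite subrK.
clearbody c.
have [c' [ec' c'e cc' c'c]] := primitive_corner_inv pe ec ce c0.
have ue : e * (1 - e) = 0 by rewrite mulrBr mulr1 ee subrr.
have eu : (1 - e) * e = 0 by rewrite mulrBl mul1r ee subrr.
have uu : (1 - e) * (1 - e) = 1 - e by rewrite mulrBr mulr1 eu subr0.
have [|g [b [gg [n bn] uE]]] := unc (d + (1 - e)).
  have hE : e + (1 - e) = 1 by rewrite addrC subrK.
  move: (1 - e) hE ue eu uu => h hE eh he hh.
  have prod x y : x * e = x -> e * y = y -> x * y = e -> (x + h) * (y + h) = 1.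
    move=> xe ey xy; rewrite mulrDl !mulrDr hh xy -{1}xe -ey -mulrA eh mulr0.
    by rewrite !mulrA he mul0r addr0 add0r.
  by exists (d' + h); split; apply: prod.
(* The unit is [1 + c], so subtracting [g] leaves the complementary idempotent [1 - g] plus [c]. *)
have [f [bE ff]] : exists f, b = f + c /\ f * f = f.
  exists (1 - g); split; last by rewrite mulrBr mulr1 mulrBl mul1r -expr2 gg
    subrr subr0.
  apply: (addrI g); rewrite -uE [RHS]addrA [g + _]addrC subrK dE.
  by rewrite -addrA [e + _]addrC subrK addrC.
have bnil : nilpotent_elt b by exists n.
have nilP x : b * x = x -> x = 0.
  move=> bx; apply: (@nilpotent_eigen b x 1 1 1) => //; by rewrite ?mulr1.
(* If [e] kills [f * y], so does [c = c * e], and then [b] fixes [f * y]. *)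
have fkill y : e * (f * y) = 0 -> f * y = 0.
  by move=> efy; apply: nilP; rewrite bE mulrDl mulrA ff -ce -(mulrA c) efy
    mulr0 addr0.
have ef0 : e * f <> 0.
  move=> ef0; have fz : f = 0 by rewrite -[f]mulr1 fkill // mulr1.
  apply: e0; apply: (@nilpotent_eigen b e c c' e) => //.
  by rewrite bE fz add0r ce ec.
have [z efz] := reg (e * f).
have [|||y [_ ye efy _]] := @primitive_corner_inv e (e * f * z * e) pe.
- by rewrite !mulrA ee.
- by rewrite -mulrA ee.
- by move=> h; apply: ef0; rewrite -efz mulrA h mul0r.
have [x [fx ex xe]] : exists x, [/\ f * x = x, e * x = e & x * e = x].
  (* The factor [y], inverse to [e * f * z * e] in the corner, normalises [x] so that
     [e * x = e]. *)
  exists (f * z * e * y); split; first by rewrite !mulrA ff.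
    by rewrite !mulrA efy.
  by rewrite -mulrA ye.
have fE : f = x * (e * f).
  apply/eqP; rewrite -subr_eq0; apply/eqP.
  have -> : f - x * (e * f) = f * (1 - x * (e * f)) by rewrite mulrBr mulr1
    (mulrA f) fx.
  by apply: fkill; rewrite mulrBr mulr1 (mulrA f) fx mulrBr !mulrA ex ee subrr.
pose p := e * f * e.
have bx : b * x = x + c by rewrite bE mulrDl fx -ce -mulrA ex.
have be : b * e = x * p + c by rewrite bE mulrDl ce {1}fE /p !mulrA.
have pep : e * p = p by rewrite /p !mulrA ee.
have pe' : p * e = p by rewrite /p -mulrA ee.
have [pE|pne] := pselect (p = e).
  (* Here [b] maps both [x] and [e] to [x + c], which makes [x + c] an eigenvector of eigenvalue
     [c + e = d]. *)
  have xc0 : x + c = 0.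
    apply: (@nilpotent_eigen b _ d d' e) => //; last by rewrite mulrDl xe ce.
    have bc : b * c = (x + c) * c by rewrite -{1}ec mulrA be pE xe.
    by rewrite mulrDr bx bc dE mulrDr [(x + c) * e]mulrDl xe ce addrC.
  by apply: d0; rewrite dE -ec -{2}ex -mulrDr addrC xc0 mulr0.
have [q [eq qe _ rq]] : exists q, [/\ e * q = q, q * e = q, q * (e - p) = e &
  (e - p) * q = e].
  have [||| q [? ? ? ?]] := @primitive_corner_inv e (e - p) pe.
  - by rewrite mulrBr ee pep.
  - by rewrite mulrBl ee pe'.
  - by move=> /eqP; rewrite subr_eq0 => /eqP /esym.
  by exists q.
have xb : b * ((x - e) * q) = x.
  rewrite mulrA mulrBr bx be opprD addrACA subrr addr0.
  by rewrite -{1}xe -mulrBr -mulrA rq xe.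
have eb : b * ((x - (x - e) * q) * c') = e.
  by rewrite mulrA mulrBr xb bx addrAC subrr add0r cc'.
(* By [xb] and [eb], [b] maps the span of [x] and [e] onto itself, so every power of [b] has [e] in
   its image. *)
have xebX k : exists y z, b ^+ k * y = x /\ b ^+ k * z = e.
  elim: k => [|k [s [t [sE tE]]]]; first by exists x, e; rewrite !mul1r.
  exists ((s - t) * q), ((s - (s - t) * q) * c').
  have stE : b ^+ k * ((s - t) * q) = (x - e) * q by rewrite mulrA mulrBr sE tE.
  rewrite exprS -!(mulrA b); split; first by rewrite stE xb.
  by rewrite (mulrA (b ^+ k)) mulrBr stE sE eb.
by have [_ [t [_ tE]]] := xebX n; apply: e0; rewrite -tE bn mul0r.
Qed.

End Semisimple.

(** * Matrix units from Peirce components *)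

Section MatrixUnits.
Variable A : pzRingType.

Lemma F2P (z : 'F_2) : z = 0 \/ z = 1.
Proof. by case: z => [[|[|m]] ?] //=; [left|right]; apply: val_inj. Qed.

(** Scalars of ['F_2] act through their representatives 0 and 1; injectivity lets identities between
    matrix entries be checked in [A], on a nonzero matrix unit. *)
Lemma mulrnF2_inj (x : A) : x <> 0 -> injective (fun z : 'F_2 => x *+ z).
Proof.
move=> x0 z w.
by case: (F2P z) (F2P w) => [->|->] [] -> //= /esym; rewrite ?mulr0n.
Qed.

Section Scaling.
Variable x : A.
Hypothesis xx : x + x = 0.

Lemma mulrnF2B (z w : 'F_2) : x *+ (z - w)%R = x *+ z - x *+ w.
Proof.
have Nx : - x = x by apply/eqP; rewrite eq_sym -addr_eq0 xx.
by case: (F2P z) (F2P w) => [->|->] [->|->];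
  rewrite ?subrr ?subr0 ?sub0r //= ?mulr0n ?sub0r ?Nx.
Qed.

Lemma mulrnF2M (y : A) (z w : 'F_2) : (x *+ z) * (y *+ w) = (x * y) *+ (z *
  w)%R.
Proof.
by case: (F2P z) (F2P w) => [->|->] [->|->];
  rewrite ?(mulr0, mul0r, mul1r) /= ?(mulr0n, mulr0, mul0r).
Qed.

Lemma mulrnF2_sum (I : finType) (z : I -> 'F_2) :
  x *+ (\sum_i z i)%R = \sum_i x *+ z i.
Proof.
apply: (big_morph (fun z : 'F_2 => x *+ z)) => // w w'.
have -> : w' = - - w' by rewrite opprK.
rewrite mulrnF2B opprK; congr (_ + _).
by rewrite -[- w']sub0r mulrnF2B sub0r opprK.
Qed.

End Scaling.

Variables (I : finType) (e : I -> A).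
Hypotheses (reg : von_neumann_regular A) (pe : forall i, primitive (e i)).
Hypotheses (orth : forall i j, i != j -> e i * e j = 0) (sum_e : \sum_i e i =
  1).
Hypothesis corner : forall i x, e i * x = x -> x * e i = x -> x <> 0 -> x = e i.

Let ee i : e i * e i = e i. Proof. by have [] := pe i. Qed.
Let e0 i : e i <> 0. Proof. by have [] := pe i. Qed.

(** Regularity gives [x] an inner inverse in [e j A e i]; both products with it are nonzero corner
    elements, which [corner] identifies. *)
Lemma peirce_inv i j x : e i * x = x -> x * e j = x -> x <> 0 ->
  exists z, [/\ e j * z = z, z * e i = z, x * z = e i & z * x = e j].
Proof.
move=> ix xj x0; have [y xyx] := reg x.
have xzx : x * (e j * y * e i) * x = x.
  by rewrite !mulrA xj -mulrA ix.
have [z [jz zi zx]] : exists z, [/\ e j * z = z, z * e i = z & x * z * x = x].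
  by exists (e j * y * e i); split=> //; [rewrite !mulrA ee|rewrite -mulrA ee].
exists z; split=> //.
- apply: corner; rewrite ?mulrA ?ix -?mulrA ?zi //.
  by move=> xz0; apply: x0; rewrite -zx xz0 mul0r.
- apply: corner; rewrite ?mulrA ?jz -?mulrA ?xj //.
  by move=> zx0; apply: x0; rewrite -zx -mulrA zx0 mulr0.
Qed.

(** With [z] inverse to [x], the nonzero corner element [y * z] is [e i], whence
    [y = y * z * x = x]. *)
Lemma peirce_unique i j x y : e i * x = x -> x * e j = x -> x <> 0 ->
  e i * y = y -> y * e j = y -> y <> 0 -> y = x.
Proof.
move=> ix xj x0 iy yj y0; have [z [jz zi xz zx]] := peirce_inv ix xj x0.
have yz : y * z = e i.
  apply: corner; rewrite ?mulrA ?iy -?mulrA ?zi //.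
  by move=> yz0; apply: y0; rewrite -yj -zx mulrA yz0 mul0r.
by rewrite -yj -zx mulrA yz ix.
Qed.

Lemma peirce_generator : exists u : I -> I -> A, forall i j,
  [/\ e i * u i j = u i j, u i j * e j = u i j
    & forall x, e i * x = x -> x * e j = x -> x <> 0 -> x = u i j].
Proof.
suff [u uP] : exists u : I * I -> A, forall ij,
  [/\ e ij.1 * u ij = u ij, u ij * e ij.2 = u ij
    & forall x, e ij.1 * x = x -> x * e ij.2 = x -> x <> 0 -> x = u ij].
  by exists (fun i j => u (i, j)) => i j; exact: (uP (i, j)).
pose P (ij : I * I) y := [/\ e ij.1 * y = y, y * e ij.2 = y
    & forall x, e ij.1 * x = x -> x * e ij.2 = x -> x <> 0 -> x = y].
suff /choice [u uP] : forall ij, exists y, P ij y by exists u.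
move=> [i j]; rewrite /P /=.
have [[x [ix xj x0]]|nx] :=
    pselect (exists x, [/\ e i * x = x, x * e j = x & x <> 0]).
  by exists x; split=> // y iy yj y0; exact: (peirce_unique ix xj x0).
(* A zero Peirce component gets the default generator 0. *)
by exists 0; split; rewrite ?mulr0 ?mul0r // => x ix xj x0; case: nx; exists x.
Qed.

Section Iso.
Variable u : I -> I -> A.
Hypothesis uP : forall i j, [/\ e i * u i j = u i j, u i j * e j = u i j
    & forall x, e i * x = x -> x * e j = x -> x <> 0 -> x = u i j].

(** Equivalently, [e i A] and [e j A] are isomorphic; the classes of this relation become the matrix
    blocks. *)
Let linked i j := u i j != 0.

Let uii i : u i i = e i.
Proof. by have [_ _ H] := uP i i; rewrite -(H (e i)). Qed.

Let umul i j k : linked i j -> linked j k -> u i j * u j k = u i k.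
Proof.
move=> /eqP ij /eqP jk; have [iu uj _] := uP i j; have [ju uk _] := uP j k.
have [z [kz zj xz zx]] := peirce_inv ju uk jk.
have [_ _ H] := uP i k; apply: H; rewrite ?mulrA ?iu -?mulrA ?uk //.
by move=> h; apply: ij; rewrite -uj -xz mulrA h mul0r.
Qed.

Let linkedxx i : linked i i. Proof. by apply/eqP; rewrite uii. Qed.

Let linkedC i j : linked i j -> linked j i.
Proof.
move=> /eqP ij; have [iu uj _] := uP i j.
have [z [jz zi xz zx]] := peirce_inv iu uj ij.
have z0 : z <> 0 by move=> z0; case: (e0 (i := i)); rewrite -xz z0 mulr0.
by have [_ _ H] := uP j i; apply/eqP; rewrite -(H z).
Qed.

Let linkedT i j k : linked i j -> linked j k -> linked i k.
Proof.
move=> ij jk; rewrite /linked -(umul ij jk).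
have [ju uk _] := uP j k; have [iu uj _] := uP i j.
have [z [kz zj xz zx]] := peirce_inv ju uk (elimN eqP jk).
apply/eqP => h; move/eqP: ij; apply.
by rewrite -uj -xz mulrA h mul0r.
Qed.

Let linked_equiv : {in [set: I] & &, equivalence_rel linked}%g.
Proof.
move=> i j k _ _ _; split=> // ij; apply/idP/idP; last exact: linkedT.
exact/linkedT/linkedC.
Qed.

(** A nonzero double of [u i j] would equal [u i j] by uniqueness, forcing [u i j = 0]. *)
Let uu i j : u i j + u i j = 0.
Proof.
have [iu uj H] := uP i j.
have [->|uj0] := eqVneq (u i j) 0; first by rewrite addr0.
apply: contrapT => h.
have := H (u i j + u i j); rewrite mulrDr mulrDl iu uj => /(_ erefl erefl h)
  /eqP.
by rewrite -subr_eq0 addrK (negbTE uj0).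
Qed.

(** The coordinate of [a] along [u i j]: since [u i j] is the only possible nonzero value, testing
    for 0 determines it. *)
Let phi i j a : 'F_2 := (e i * a * e j != 0)%:R.

Let phiE i j a : e i * a * e j = u i j *+ phi i j a.
Proof.
rewrite /phi; have [->|/eqP h] := eqVneq (e i * a * e j) 0; first by rewrite
  mulr0n.
by have [_ _ H] := uP i j; apply: H => //; [rewrite !mulrA ee|rewrite -mulrA
  ee].
Qed.

Let classes := equivalence_partition linked [set: I].
Let C (c : 'I_#|classes|) : {set I} := enum_val c.
Let n c := #|C c|.
Let v c (s : 'I_(n c)) : I := enum_val s.

Let classesP : finset.partition classes [set: I].
Proof. exact: equivalence_partitionP. Qed.

Let vC c (s : 'I_(n c)) i : (i \in C c) = linked (v s) i.
Proof.
have Cc : C c \in classes by exact: enum_valP.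
have vs : v s \in C c by exact: enum_valP.
have /and3P [_ triv _] := classesP.
by rewrite -(finset.def_pblock triv Cc vs) pblock_equivalence_partition ?inE.
Qed.

Let linkedv c (s t : 'I_(n c)) : linked (v s) (v t).
Proof. by rewrite -vC; exact: enum_valP. Qed.

Let v_surj i : exists c (s : 'I_(n c)), v s = i.
Proof.
have iC : i \in finset.cover classes by rewrite (finset.cover_partition
  classesP) inE.
have Pc : finset.pblock classes i \in classes by rewrite finset.pblock_mem.
pose c := enum_rank_in Pc (finset.pblock classes i).
have ic : i \in C c by rewrite /C enum_rankK_in // finset.mem_pblock.
by exists c, (enum_rank_in ic i); rewrite /v enum_rankK_in.
Qed.

Let n_gt0 c : (0 < n c)%N.
Proof.
rewrite card_gt0; apply/eqP => c0; have /and3P [_ _] := classesP.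
by rewrite -c0 enum_valP.
Qed.

Let linked_class c c' (s : 'I_(n c)) (s' : 'I_(n c')) : linked (v s) (v s') ->
  c = c'.
Proof.
rewrite -vC => vs'; have vs'' : v s' \in C c' by exact: enum_valP.
have /and3P [_ triv _] := classesP.
apply: enum_val_inj; rewrite -/(C c) -/(C c').
by rewrite -(finset.def_pblock triv _ vs') ?(finset.def_pblock triv _ vs'')
  ?enum_valP.
Qed.

Let D := ring_dsum (fun c => 'M['F_2]_(n c) : pzRingType).

Let f a : D := [ffun c => \matrix_(s, t) phi (v s) (v t) a].

Let fE a c s t : f a c s t = phi (v s) (v t) a.
Proof. by rewrite ffunE mxE. Qed.

Let f_additive : additive f.
Proof.
move=> a b; apply/ffunP => c; apply/matrixP => s t.
rewrite !ffunE !mxE; apply: (mulrnF2_inj (elimN eqP (linkedv s t))).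
by rewrite /= mulrnF2B // -!phiE mulrBr mulrBl.
Qed.

Let f_monoid : monoid_morphism f.
Proof.
split=> [|a b]; apply/ffunP => c; apply/matrixP => s t;
  apply: (mulrnF2_inj (elimN eqP (linkedv s t))); rewrite /= fE -phiE !ffunE
    !mxE.
  rewrite mulr1; have [<-|st] := eqVneq s t; first by rewrite uii ee.
  by rewrite orth // (inj_eq enum_val_inj).
(* Inserting [1 = \sum_k e k] between the factors produces the matrix product; terms with [k]
   outside the block [C c] vanish. *)
have -> : e (v s) * (a * b) * e (v t) =
    \sum_k (e (v s) * a * e k) * (e k * b * e (v t)).
  rewrite -[a in LHS]mulr1 -sum_e mulr_sumr !mulr_suml mulr_sumr mulr_suml.
  by apply: eq_bigr => k _; rewrite -{1}(ee k) !mulrA.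
rewrite mulrnF2_sum // (bigID (mem (C c))) /= [X in _ + X]big1 => [|k].
  rewrite addr0 big_enum_val; apply: eq_bigr => k _.
  by rewrite !phiE !mxE mulrnF2M umul ?linkedv.
by rewrite (vC s) => /negPn/eqP h; rewrite phiE h mul0rn mul0r.
Qed.

(** An element is the sum of its Peirce components, and those joining different blocks are 0. *)
Let f_inj : injective f.
Proof.
move=> a b fab; rewrite -[a]mul1r -[b]mul1r -sum_e !mulr_suml; apply: eq_bigr
  => i _.
rewrite -[e i * a]mulr1 -[e i * b]mulr1 -sum_e !mulr_sumr; apply: eq_bigr => j
  _.
rewrite !phiE; have [/eqP ->|ij] := boolP (u i j == 0); first by rewrite
  !mul0rn.
have [c [s si]] := v_surj i; have [c' [t tj]] := v_surj j.
have cc' : c = c' by apply: (@linked_class _ _ s t); rewrite si tj.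
by case: c' / cc' t tj => t tj; rewrite -si -tj -!fE fab.
Qed.

Let f_surj g : exists a, f a = g.
Proof.
pose T := {c : 'I_#|classes| & ('I_(n c) * 'I_(n c))%type}.
(* The entry of [g] at the position given by [i] and [j], or 0 when they lie in different blocks. *)
pose G i j : 'F_2 :=
  if [pick x : T | (v (tagged x).1 == i) && (v (tagged x).2 == j)] is Some x
  then (g (tag x) : 'M_(n (tag x))) (tagged x).1 (tagged x).2 else 0.
have GE c (s t : 'I_(n c)) : G (v s) (v t) = (g c : 'M_(n c)) s t.
  rewrite /G; case: pickP => [[c' [s' t']] /= /andP [/eqP es /eqP et]|/(_
    (Tagged _ (s, t)))].
    have cc' : c = c' by apply: (@linked_class _ _ s s'); rewrite es.
    case: c' / cc' s' t' es et => s' t' es et.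
    by rewrite (enum_val_inj es) (enum_val_inj et).
  by rewrite /= !eqxx.
exists (\sum_i \sum_j u i j *+ G i j); apply/ffunP => c; apply/matrixP => s t.
apply: (mulrnF2_inj (elimN eqP (linkedv s t))); rewrite /= fE -phiE -GE.
rewrite mulr_sumr mulr_suml (bigD1 (v s)) //= [X in _ + X]big1 ?addr0 => [|i
  si].
  rewrite mulr_sumr mulr_suml (bigD1 (v t)) //= [X in _ + X]big1 ?addr0 => [|j
    tj].
    by have [iu uj _] := uP (v s) (v t); rewrite mulrnAr mulrnAl iu uj.
  have [iu uj _] := uP (v s) j; rewrite mulrnAr mulrnAl iu -uj -mulrA orth //.
  by rewrite mulr0 mul0rn.
rewrite mulr_sumr mulr_suml big1 // => j _.
have [iu uj _] := uP i j; rewrite mulrnAr -iu mulrA orth 1?eq_sym //.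
by rewrite mul0r mul0rn mul0r.
Qed.

Lemma matrix_units_dsum_F2 : dsum_of_matrix_rings_F2 A.
Proof.
pose fadd := GRing.isZmodMorphism.Build A D f f_additive.
pose fmon := GRing.isMonoidMorphism.Build A D f f_monoid.
pose fM : {rmorphism A -> D} := HB.pack f fadd fmon.
exists #|classes|, n; split=> //; exists fM.
have [h hP] := choice f_surj.
by exists h => // a; apply: f_inj; rewrite hP.
Qed.

End Iso.

Lemma orthogonal_corners_dsum_F2 : dsum_of_matrix_rings_F2 A.
Proof. by have [u uP] := peirce_generator; exact: matrix_units_dsum_F2 uP. Qed.

End MatrixUnits.

Lemma UNC_semisimple_dsum_F2 (A : pzRingType) :
  semisimple_artinian A -> UNC_ring A -> dsum_of_matrix_rings_F2 A.
Proof.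
move=> [ss art] unc; have reg := semisimple_von_neumann_regular ss.
have [I [e [pe orth sum_e]]] := artinian_primitive_decomposition art (mulr1 1).
apply: (orthogonal_corners_dsum_F2 reg pe orth sum_e) => i x.
exact: UNC_primitive_corner.
Qed.

(** * Matrices over F_2 are nil-clean *)

Section NilCleanTransfer.
Variable R : pzRingType.

Lemma nil_clean_conj (p q a : R) :
  q * p = 1 -> nil_clean_elt a -> nil_clean_elt (p * a * q).
Proof.
move=> qp [e [b [e2 [n bn] ->]]].
have conjM x y : (p * x * q) * (p * y * q) = p * (x * y) * q.
  by rewrite -!mulrA (mulrA q) qp mul1r.
exists (p * e * q), (p * b * q); split.
- by rewrite expr2 conjM -expr2 e2.
(* The exponent must be positive, since [p * q] may differ from 1. *)
- exists n.+1; have -> k : (p * b * q) ^+ k.+1 = p * b ^+ k.+1 * q.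
    by elim: k => [|k IH]; rewrite ?expr1 // exprS IH conjM -exprS.
  by rewrite exprS bn mulr0 mulr0 mul0r.
- by rewrite mulrDr mulrDl.
Qed.

End NilCleanTransfer.

Section MatrixF2.
Local Notation F := 'F_2.

Lemma F2mx_addxx m n (x : 'M[F]_(m, n)) : x + x = 0.
Proof.
by apply/matrixP => i j; rewrite !mxE; case: (F2P (x i j)) => -> //; apply:
  val_inj.
Qed.

Lemma block_lower_exp m1 m2 (A : 'M[F]_m1) (C : 'M[F]_(m2, m1)) (D : 'M[F]_m2)
  k :
  exists X, (block_mx A 0 C D : 'M_(m1 + m2)) ^+ k = block_mx (A ^+ k) 0 X (D
    ^+ k).
Proof.
elim: k => [|k [X IH]]; first by exists 0; rewrite -scalar_mx_block.
exists (C *m A ^+ k + D *m X).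
rewrite !exprS IH; rewrite -[LHS]/(_ *m _) mulmx_block.
by rewrite mul0mx !mulmx0 mul0mx addr0 add0r !add0r.
Qed.

(** All of [C] goes into the nilpotent part, so the idempotent stays block diagonal. *)
Lemma block_lower_nil_clean m1 m2 (A : 'M[F]_m1) (C : 'M[F]_(m2, m1)) (D :
  'M[F]_m2) :
  nil_clean_elt A -> nil_clean_elt D ->
  nil_clean_elt (block_mx A 0 C D : 'M_(m1 + m2)).
Proof.
move=> [e [b [e2 [n bn] ->]]] [e' [b' [e'2 [n' b'n] ->]]].
exists (block_mx e 0 0 e'), (block_mx b 0 C b'); split.
- rewrite expr2 -[LHS]/(_ *m _) mulmx_block !mul0mx !mulmx0 !addr0 add0r.
  by rewrite -[in RHS]e2 -[in RHS]e'2 !expr2.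
(* The power [n + n'] kills both diagonal blocks, and squaring kills the remaining corner block. *)
- exists ((n + n') * 2)%N; rewrite exprM.
  have [X ->] := block_lower_exp b C b' (n + n').
  rewrite !exprD bn b'n mul0r mulr0 expr2 -[LHS]/(_ *m _) mulmx_block.
  by rewrite !mul0mx !mulmx0 !addr0 block_mx0.
- by rewrite add_block_mx !addr0 add0r.
Qed.

Section Basis.
Variables (n : nat) (w : nat -> 'rV[F]_n).
Let P : 'M[F]_n := \matrix_(i < n) w i.
Hypothesis Pu : P \in unitmx.
Hypothesis w_ge : forall i, (n <= i)%N -> w i = 0.

Lemma basis_mx_eq (X Y : 'M[F]_n) :
  (forall i, (i < n)%N -> w i *m X = w i *m Y) -> X = Y.
Proof.
move=> XY; rewrite -[X](mulKmx Pu) -[Y](mulKmx Pu); congr (_ *m _).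
by apply/row_matrixP => i; rewrite !row_mul rowK XY.
Qed.

(** As [w] vanishes from [n] on, the shift sends the last basis vector to 0 and is nilpotent. *)
Lemma basis_shift : exists2 N : 'M[F]_n,
  nilpotent_elt N & forall i, w i *m N = w i.+1.
Proof.
pose N : 'M[F]_n := invmx P *m \matrix_(i < n) w i.+1.
have wN i : w i *m N = w i.+1.
  have [lt_in|ge_in] := ltnP i n; last by rewrite !w_ge ?mul0mx // leqW.
  have -> : w i = row (Ordinal lt_in) P by rewrite rowK.
  by rewrite -row_mul /N mulKVmx // rowK.
exists N => //; exists n; apply: basis_mx_eq => i _.
have wNk k : w i *m (N ^+ k) = w (i + k)%N.
  elim: k => [|k IH]; first by rewrite addn0 mulmx1.
  by rewrite exprSr -[N ^+ k * N]/(_ *m _) mulmxA IH wN addnS.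
by rewrite wNk mulmx0 w_ge // leq_addl.
Qed.

(** [T - N] sends [w i] to [w i *m T - w i.+1], so it is idempotent once it fixes these vectors. *)
Lemma shift_nil_clean (T N : 'M[F]_n) : nilpotent_elt N ->
  (forall i, w i *m N = w i.+1) ->
  (forall i, (i < n)%N ->
     (w i *m T - w i.+1) *m (T - N) = w i *m T - w i.+1) ->
  nil_clean_elt T.
Proof.
move=> Nnil wN idem; exists (T - N), N; split=> //; last by rewrite subrK.
apply: basis_mx_eq => i lt_in.
by rewrite expr2 -[_ * _]/(_ *m _) mulmxA (mulmxBr (w i)) wN idem.
Qed.

End Basis.

Section Krylov.
Variables (n : nat) (T : 'M[F]_n) (v : 'rV[F]_n).

Definition krylov (i : nat) : 'rV[F]_n := v *m T ^+ i.
Local Notation k := krylov.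

Definition krylov_mx : 'M[F]_n := \matrix_(i < n) k i.

Lemma krylovS i : k i *m T = k i.+1.
Proof. by rewrite /krylov -mulmxA exprSr. Qed.

Lemma krylovD i j : k (i + j) = k i *m T ^+ j.
Proof. by rewrite /krylov -mulmxA exprD. Qed.

Lemma krylov_relation : krylov_mx \in unitmx ->
  exists c : 'I_n -> F, k n = \sum_i c i *: k i.
Proof.
move=> Ku; exists ((k n *m invmx krylov_mx) 0).
rewrite -[LHS](mulmxKV Ku) mulmx_sum_row.
by apply: eq_bigr => i _; rewrite rowK.
Qed.

End Krylov.

(* The nilpotent part of [T] shifts the Krylov basis; what is left is a rank one
   map fixing its image as soon as the trace [c l] of the companion form
   is 1. *)
Lemma cyclic_nil_clean_trace1 n (T : 'M[F]_n) v (c : 'I_n -> F) (l : 'I_n) :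
  krylov_mx T v \in unitmx -> krylov T v n = \sum_i c i *: krylov T v i ->
  l.+1 = n -> c l = 1 -> nil_clean_elt T.
Proof.
move=> Ku kn ln cl; pose k := krylov T v.
pose w i := if (i < n)%N then k i else 0.
have w_ge i : (n <= i)%N -> w i = 0 by rewrite /w leqNgt => /negbTE ->.
have w_lt i : (i < n)%N -> w i = k i by rewrite /w => ->.
have wu : \matrix_(i < n) w i \in unitmx.
  rewrite (_ : \matrix_(i < n) w i = krylov_mx T v) //.
  by apply/row_matrixP => i; rewrite !rowK w_lt.
have [N Nnil wN] := basis_shift wu w_ge.
apply: (shift_nil_clean wu Nnil wN) => i lt_in.
have step j : (j < n)%N -> j != l :> nat -> w j *m T - w j.+1 = 0.
  move=> jn jl; rewrite !w_lt ?krylovS ?subrr //.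
  by rewrite ltn_neqAle jn andbT -ln eqSS.
have [il|] := eqVneq i l; last by move=> /(step _ lt_in) ->; rewrite mul0mx.
have wl : w i *m T - w i.+1 = k n.
  by rewrite il ln (w_ge n) // subr0 w_lt ?ltn_ord // krylovS ln.
(* In the expansion of [k n], [T - N] kills every term but the last, which it sends to [k n]. *)
rewrite wl {1}/k kn mulmx_suml (bigD1 l) //= cl scale1r big1 => [|j jl].
  by rewrite addr0 -/k -w_lt ?ltn_ord // mulmxBr wN -il wl.
by rewrite -scalemxAl -/k -w_lt // mulmxBr wN step // scaler0.
Qed.

(* When the trace is 0 the idempotent must have even rank. The last basis vector
   is corrected so that [T] minus the shift has rank two and again fixes its
   image; [g] is forced by the coefficient [c] of degree [n - 2]. *)
Lemma cyclic_nil_clean_trace0 m (T : 'M[F]_m.+3) v (c : 'I_m.+3 -> F) :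
  krylov_mx T v \in unitmx ->
  krylov T v m.+3 = \sum_i c i *: krylov T v i ->
  c ord_max = 0 -> nil_clean_elt T.
Proof.
move=> Ku kn cmax; pose k := krylov T v.
have k2 (x : 'rV[F]_m.+3) : - x = x.
  by apply/eqP; rewrite eq_sym -addr_eq0 F2mx_addxx.
have addK (x y : 'rV[F]_m.+3) : x + y + y = x by rewrite -{2}[y]k2 addrK.
pose a : F := c (widen_ord (leqnSn _) ord_max); pose g : F := 1 + a.
pose w i := if (i < m.+2)%N then k i
            else if i == m.+2 then k m.+2 + k m.+1 + g *: k m else 0.
have w_ge i : (m.+3 <= i)%N -> w i = 0.
  by move=> mi; rewrite /w ltnNge (ltnW mi) /= gtn_eqF.
have w_lt i : (i < m.+2)%N -> w i = k i by rewrite /w => ->.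
have wm2 : w m.+2 = k m.+2 + k m.+1 + g *: k m by rewrite /w ltnn eqxx.
have wu : \matrix_(i < m.+3) w i \in unitmx.
  rewrite -row_full_unit -sub1mx; apply: submx_trans (_ : (krylov_mx T v <=
    _)%MS).
    by rewrite sub1mx row_full_unit.
  have wP i : (i < m.+3)%N -> (w i <= \matrix_(i < m.+3) w i)%MS.
    by move=> im; rewrite -[w i](rowK (fun j : 'I__ => w j) (Ordinal im))
      row_sub.
  apply/row_subP => i; rewrite rowK -/(k i).
  have [im|mi] := ltnP i m.+2; first by rewrite -w_lt // wP // ltnS ltnW.
  have -> : i = m.+2 :> nat by apply/eqP; rewrite eqn_leq mi -ltnS ltn_ord.
  (* In characteristic 2 the correction of the last vector is undone by adding it again, so [w]
     spans the Krylov basis. *)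
  have -> : k m.+2 = w m.+2 + w m.+1 + g *: w m.
    by rewrite addrAC wm2 !w_lt // !addK.
  by rewrite !addmx_sub ?scalemx_sub ?wP // !ltnS ?leqnSn // ltnW.
have [N Nnil wN] := basis_shift wu w_ge.
apply: (shift_nil_clean wu Nnil wN) => i lt_in.
have step j : (j < m.+1)%N -> w j *m T - w j.+1 = 0.
  by move=> jm; rewrite !w_lt ?ltnS ?krylovS ?subrr // ltnW.
have stepN j : (j < m.+1)%N -> w j *m (T - N) = 0.
  by move=> jm; rewrite mulmxBr wN step.
have [im|] := ltnP i m.+1; first by rewrite step // mul0mx.
rewrite leq_eqVlt => /predU1P [<-|im].
  (* [T - N] kills [w m], so it acts on this vector as on [w m.+1] and thus fixes it. *)
  have x1 : w m.+1 *m T - w m.+2 = w m.+1 + g *: w m.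
    by rewrite wm2 !w_lt // krylovS -/k -addrA opprD addrA subrr add0r k2.
  rewrite {1}x1 mulmxDl -scalemxAl (stepN m) // scaler0 addr0.
  by rewrite mulmxBr wN.
have {im lt_in} -> : i = m.+2 by apply/eqP; rewrite eqn_leq im -ltnS lt_in.
rewrite (w_ge m.+3) // subr0.
pose d (j : 'I_m.+1) := c (widen_ord (leqnSn _) (widen_ord (leqnSn _) j)).
(* The choice [g = 1 + a] gives [k m.+1] the coefficient 1, so [w m.+2] reappears; [T - N] kills all
   other terms. *)
have x2 : w m.+2 *m T = w m.+2 + (\sum_(j < m.+1) d j *: w j + g *: w m).
  rewrite wm2 !mulmxDl -scalemxAl !krylovS -/k [k m.+3]kn big_ord_recr /= cmax
    scale0r.
  rewrite addr0 big_ord_recr /= -/a -/k w_lt // [in RHS]addrC -!addrA.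
  rewrite [in RHS](eq_bigr (fun j : 'I_m.+1 => d j *: k j)) => [|j _]; last by
    rewrite w_lt // ltnS ltnW.
  congr (_ + _); transitivity (k m.+2 + k m.+1).
    by rewrite addrCA /g scalerDl scale1r; congr (_ + _); rewrite addrC addK.
  by rewrite [RHS]addrC addrA addK.
rewrite {1}x2 mulmxDl mulmxBr wN (w_ge m.+3) // subr0 mulmxDl -scalemxAl (stepN
  m) //.
rewrite scaler0 addr0 mulmx_suml big1 ?addr0 // => j _.
by rewrite -scalemxAl stepN // scaler0.
Qed.

Lemma cyclic_nil_clean n (T : 'M[F]_n) v : krylov_mx T v \in unitmx ->
  nil_clean_elt T.
Proof.
move=> Ku; have [c kn] := krylov_relation Ku.
case: n => [|[|[|m]]] in T v Ku c kn *.
- by exists 0, 0; split; [exact: flatmx0|exists 0%N; exact: flatmx0|rewrite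
  addr0; exact: flatmx0].
- exists T, 0; split; [|by exists 1%N|by rewrite addr0].
  rewrite [T]mx11_scalar expr2 -[_ * _]/(_ *m _) -scalar_mxM.
  by case: (F2P (T 0 0)) => ->; rewrite ?mulr0 ?mulr1.
- have [c1|c1] := F2P (c ord_max); last exact: (cyclic_nil_clean_trace1 Ku kn _
  c1).
  (* In size 2 and trace 0, [T] squares to the scalar [c 0], which is idempotent, so [T] minus that
     scalar squares to 0 in characteristic 2. *)
  have T2 : T *m T = (c 0)%:M.
    apply: (basis_mx_eq Ku) => i _.
    rewrite mulmxA !krylovS -[i.+2]/(2 + i)%N krylovD kn !big_ord_recl big_ord0
      addr0.
    rewrite (_ : lift ord0 ord0 = ord_max) ?c1 ?scale0r ?addr0; last exact:
      val_inj.
    by rewrite mul_mx_scalar -scalemxAl -krylovD.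
  exists (c 0)%:M, (T - (c 0)%:M); split; last by rewrite addrC subrK.
    by rewrite expr2 -[_ * _]/(_ *m _) -scalar_mxM; case: (F2P (c 0)) => ->;
      rewrite ?mulr0 ?mulr1.
  exists 2; rewrite expr2 -[_ * _]/(_ *m _) mulmxBr !mulmxBl T2 scalar_mxC.
  rewrite -scalar_mxM (_ : c 0 * c 0 = c 0) ?opprB ?F2mx_addxx //.
  by case: (F2P (c 0)) => ->; rewrite ?mulr0 ?mulr1.
- have [c1|c1] := F2P (c ord_max); last exact: (cyclic_nil_clean_trace1 Ku kn _
  c1).
  exact: cyclic_nil_clean_trace0 Ku kn c1.
Qed.

(** By Cayley-Hamilton [v *m T ^+ n] is a combination of the lower Krylov vectors, even when these
    are dependent. *)
Lemma krylov_stable n (T : 'M[F]_n) v : stablemx (krylov_mx T v) T.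
Proof.
case: n => [|n] in T v *; first by rewrite flatmx0 sub0mx.
have kK i : (i < n.+1)%N -> (krylov T v i <= krylov_mx T v)%MS.
  by move=> lt_in; rewrite -[krylov T v i](rowK (fun j : 'I__ => krylov T v j)
    (Ordinal lt_in)) row_sub.
apply/row_subP => i; rewrite row_mul rowK krylovS.
have := ltn_ord i; rewrite leq_eqVlt => /predU1P [->|]; last exact: kK.
have : v *m horner_mx T (char_poly T) = 0 by rewrite Cayley_Hamilton mulmx0.
rewrite -[char_poly T]coefK poly_def size_char_poly rmorph_sum /= mulmx_sumr.
rewrite big_ord_recr /= linearZ /= rmorphXn /= horner_mx_X.
have := monicP (char_poly_monic T); rewrite /lead_coef size_char_poly /= => ->.
rewrite scale1r -/(krylov T v n.+1) addrC => /eqP; rewrite addr_eq0 => /eqP ->.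
rewrite eqmx_opp; apply: summx_sub => j _.
rewrite linearZ /= rmorphXn /= horner_mx_X -scalemxAr scalemx_sub //.
exact: kK.
Qed.

(** Factor [U] as an invertible matrix times [pid_mx (\rank U)] times an invertible [P]. Conjugation
    by [P] moves the row space of [U] to the span of the first basis vectors, so [T] becomes block
    lower triangular with smaller diagonal blocks. *)
Lemma stable_nil_clean n (T U : 'M[F]_n) :
  (forall m, (m < n)%N -> nil_clean_ring ('M[F]_m : pzRingType)) ->
  stablemx U T -> U != 0 -> U \notin unitmx -> nil_clean_elt T.
Proof.
move=> IH UT U0 nUu.
have r_gt0 : (0 < \rank U)%N by rewrite lt0n mxrank_eq0.
have r_lt : (\rank U < n)%N.
  by rewrite ltn_neqAle rank_leq_row andbT; move: nUu; rewrite -row_free_unit.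
have [s sE] : {s | n = (\rank U + s)%N} by exists (n - \rank U)%N; rewrite
  subnKC // ltnW.
have [P [X [Pu PX]]] : exists P X : 'M[F]_n, P \in unitmx /\
    pid_mx (\rank U) *m (P *m T *m invmx P) = X *m pid_mx (\rank U).
  have := mulmx_ebase U; move: (col_ebase_unit U) (row_ebase_unit U).
  move: (col_ebase U) (row_ebase U) (pid_mx _) => L P D Lu Pu UE.
  have /submxP [Y YE] := UT.
  exists P, (invmx L *m Y *m L); split=> //.
  have -> : D *m (P *m T *m invmx P) = invmx L *m (U *m T) *m invmx P.
    by rewrite -UE -[L *m D *m P]mulmxA -!(mulmxA L) (mulKmx Lu) !mulmxA.
  by rewrite YE -UE !mulmxA mulmxK.
move: (\rank U) r_gt0 r_lt sE PX => r r_gt0 r_lt sE PX.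
subst n; set M := P *m T *m invmx P in PX.
have ur0 : ursubmx M = 0.
  move: PX; rewrite -[M]submxK -[X]submxK pid_mx_block !mulmx_block.
  rewrite !mul1mx !mul0mx !mulmx0 !addr0 => /eq_block_mx [_ ur _ _].
  by rewrite block_mxKur ur.
have TE : T = invmx P *m M *m P by rewrite /M !mulmxA mulVmx // mul1mx mulmxKV.
rewrite TE; apply: nil_clean_conj; first exact: mulmxV.
rewrite -[M]submxK ur0; apply: block_lower_nil_clean; apply: IH => //.
by rewrite -{1}[s]add0n ltn_add2r.
Qed.

Lemma matrix_F2_nil_clean n : nil_clean_ring ('M[F]_n : pzRingType).
Proof.
elim/ltn_ind: n => -[|n] IH T.
  by exists 0, 0; split; [exact: flatmx0|exists 0%N; exact: flatmx0|rewrite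
    addr0; exact: flatmx0].
(* Row 0 of the Krylov matrix is [v] itself, so a nonzero [v] makes this matrix nonzero. *)
pose v : 'rV[F]_n.+1 := delta_mx 0 0.
have [Ku|nKu] := boolP (krylov_mx T v \in unitmx); first exact:
  cyclic_nil_clean Ku.
have K0 : krylov_mx T v != 0.
  apply/eqP => K0; have /rowP /(_ 0) := congr1 (row 0) K0.
  rewrite rowK row0 /krylov mulmx1 !mxE !eqxx => /eqP; by rewrite oner_eq0.
exact: stable_nil_clean IH (krylov_stable T v) K0 nKu.
Qed.

End MatrixF2.

(** * Direct sums and isomorphic copies of nil-clean rings *)

Section DirectSumNilClean.

Lemma dsum_exp (I : finType) (F : I -> pzRingType) (f : ring_dsum F) k i :
  (f ^+ k) i = f i ^+ k.
Proof.
elim: k => [|k IH]; first by rewrite !expr0 ffunE.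
by rewrite !exprS -IH ffunE.
Qed.

Lemma dsum_nil_clean (I : finType) (F : I -> pzRingType) :
  (forall i, nil_clean_ring (F i)) -> nil_clean_ring (ring_dsum F).
Proof.
move=> ncF f.
have ncf i : exists x, exists b n, [/\ x ^+ 2 = x, b ^+ n = 0 & f i = x + b].
  by have [x [b [x2 [n bn] fE]]] := ncF i (f i); exists x, b, n.
pose e : ring_dsum F := [ffun i => sval (cid (ncf i))].
have eP i : exists b n, [/\ e i ^+ 2 = e i, b ^+ n = 0 & f i = e i + b].
  by rewrite ffunE; case: cid.
clearbody e.
exists e, (f - e); split; last by rewrite addrC subrK.
  by apply/ffunP => i; rewrite dsum_exp; have [b [n []]] := eP i.
have nP i : exists n, (f i - e i) ^+ n == 0.
  by have [b [n [_ bn ->]]] := eP i; exists n; rewrite addrC addKr bn.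
(* The nilpotency exponents vary with [i]; their sum bounds them all because the index type is
   finite. *)
exists (\sum_i ex_minn (nP i))%N; apply/ffunP => i.
rewrite dsum_exp !ffunE (bigD1 i) //= exprD.
by case: ex_minnP => n /eqP -> _; rewrite mul0r.
Qed.

Lemma nil_clean_iso (A B : pzRingType) :
  ring_isomorphic A B -> nil_clean_ring B -> nil_clean_ring A.
Proof.
move=> [f [g fK gK]] ncB a; have [e [b [e2 [n bn] faE]]] := ncB (f a).
have f_inj := can_inj fK.
exists (g e), (g b); split.
- by apply: f_inj; rewrite rmorphXn /= gK.
- by exists n; apply: f_inj; rewrite rmorphXn rmorph0 /= gK.
- by apply: f_inj; rewrite rmorphD /= !gK.
Qed.

End DirectSumNilClean.

Theorem theorem2p14 (R : pzRingType) (Rsl : semilocal R) :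
  (UNC_ring R <-> nil_clean_ring R) /\
  (nil_clean_ring R <->
     nil_set (jacobson R) /\ dsum_of_matrix_rings_F2 (jacobson_quot R)).
Proof.
have nc_unc : nil_clean_ring R -> UNC_ring R by move=> nc u _; exact: nc.
have unc_mx : UNC_ring R ->
    nil_set (jacobson R) /\ dsum_of_matrix_rings_F2 (jacobson_quot R).
  move=> unc; split; first exact: UNC_jacobson_nil.
  exact: UNC_semisimple_dsum_F2 Rsl (UNC_jacobson_quot unc).
have mx_nc : nil_set (jacobson R) /\ dsum_of_matrix_rings_F2 (jacobson_quot R)
  ->
    nil_clean_ring R.
  move=> [Jnil [k [n [_ iso]]]]; apply: (nil_clean_lift Jnil).
  apply: (nil_clean_iso iso); apply: dsum_nil_clean => i.
  exact: matrix_F2_nil_clean.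
split; split=> //; first by move=> /unc_mx /mx_nc.
by move=> /nc_unc /unc_mx.
Qed.
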